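(* Let $\mathsf{C}$ be a strictly positive Markov category. Let $p:\Theta\to X$ be a statistical model in $\mathsf{C}$ and let $s:X\to V$ be a statistic for $p$. Then $s$ is sufficient for $p$ if and only if there is a morphism $\alpha:V\to X$ in $\mathsf{C}$ such that $\alpha\circ s\circ p=p$ and $s\circ\alpha=_{sp\text{-a.s.}}\mathrm{id}_V$.
   Context: A Markov category is a symmetric monoidal category $(\mathsf{C},\otimes,I)$ with symmetry $\mathsf{swap}_{X,Y}:X\otimes Y\to Y\otimes X$, in which every object $X$ is equipped with morphisms $\mathsf{copy}_X:X\to X\otimes X$ and $\mathsf{del}_X:X\to I$ forming a commutative comonoid (coassociative, counital, cocommutative), such that: (i) $\mathsf{del}_{X\otimes Y}$ is $\mathsf{del}_X\otimes\mathsf{del}_Y$ followed by $I\otimes I\cong I$; (ii) $\mathsf{copy}_{X\otimes Y}$ is $\mathsf{copy}_X\otimes\mathsf{copy}_Y$ followed by the canonical isomorphism $(X\otimes X)\otimes(Y\otimes Y)\cong(X\otimes Y)\otimes(X\otimes Y)$ swapping the two middle factors; (iii) $\mathsf{del}_Y\circ f=\mathsf{del}_X$ for every $f:X\to Y$. Associators and unitors are suppressed in formulas. Deterministic: $f:X\to Y$ is deterministic if $\mathsf{copy}_Y\circ f=(f\otimes f)\circ\mathsf{copy}_X$. Almost sure equality: for $p:\Theta\to X$ and $f,g:X\to Y$, write $f=_{p\text{-a.s.}}g$ if $(\mathrm{id}_X\otimes f)\circ\mathsf{copy}_X\circ p=(\mathrm{id}_X\otimes g)\circ\mathsf{copy}_X\circ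 p$. Almost surely deterministic: for $p:\Theta\to X$, a morphism $f:X\to Y$ is $p$-a.s. deterministic if $\mathsf{copy}_Y\circ f=_{p\text{-a.s.}}(f\otimes f)\circ\mathsf{copy}_X$. Strictly positive: $\mathsf{C}$ is strictly positive if for all $p:\Theta\to X$, $f:X\to Y$, $g:Y\to Z$ such that $g\circ f$ is $p$-a.s. deterministic, one has $(g\otimes\mathrm{id}_Y)\circ\mathsf{copy}_Y\circ f=_{p\text{-a.s.}}\big((g\circ f)\otimes f\big)\circ\mathsf{copy}_X$. A statistical model with values in $X$ is any morphism $p:\Theta\to X$. A statistic for $p:\Theta\to X$ is a deterministic morphism $s:X\to V$. A statistic $s:X\to V$ is sufficient for $p$ if there is $\alpha:V\to X$ such that $(s\otimes\mathrm{id}_X)\circ\mathsf{copy}_X\circ p=(\mathrm{id}_V\otimes\alpha)\circ\mathsf{copy}_V\circ s\circ p$. *)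

(* Defs.v *)
Set Implicit Arguments.
Unset Strict Implicit.
Unset Printing Implicit Defensive.

Declare Scope object_scope.
Delimit Scope object_scope with obj.
Declare Scope morphism_scope.
Delimit Scope morphism_scope with mor.

Record category := Category {
  object :> Type;
  hom : object -> object -> Type;
  idm : forall X, hom X X;
  comp : forall X Y Z, hom Y Z -> hom X Y -> hom X Z;
  comp_idl : forall X Y (f : hom X Y), comp (idm Y) f = f;
  comp_idr : forall X Y (f : hom X Y), comp f (idm X) = f;
  comp_assoc : forall W X Y Z (h : hom Y Z) (g : hom X Y) (f : hom W X),
    comp h (comp g f) = comp (comp h g) f
}.

Arguments hom {c} X%_obj Y%_obj.
Arguments idm {c} X%_obj.
Arguments comp {c X Y Z} g%_mor f%_mor.
Bind Scope object_scope with object.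
Bind Scope morphism_scope with hom.

Reserved Notation "x ⊗ y" (at level 40, left associativity).
Notation "g ∘ f" := (comp g f)
  (at level 40, left associativity) : morphism_scope.

Open Scope object_scope.
Open Scope morphism_scope.

Definition mutually_inverse (C : category) (X Y : C)
    (f : hom X Y) (g : hom Y X) : Prop :=
  g ∘ f = idm X /\ f ∘ g = idm Y.

Record symmetric_monoidal_category := SymmetricMonoidalCategory {
  smc_category :> category;
  unit_object : smc_category;
  tensor : smc_category -> smc_category -> smc_category
    where "X ⊗ Y" := (tensor X Y) : object_scope;
  tensor_hom : forall (X X' Y Y' : smc_category),
    hom X X' -> hom Y Y' -> hom (X ⊗ Y) (X' ⊗ Y')
    where "f ⊗ g" := (tensor_hom f g) : morphism_scope;
  assoc : forall X Y Z, hom ((X ⊗ Y) ⊗ Z) (X ⊗ (Y ⊗ Z));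
  assoc_inv : forall X Y Z, hom (X ⊗ (Y ⊗ Z)) ((X ⊗ Y) ⊗ Z);
  left_unitor : forall X, hom (unit_object ⊗ X) X;
  left_unitor_inv : forall X, hom X (unit_object ⊗ X);
  right_unitor : forall X, hom (X ⊗ unit_object) X;
  right_unitor_inv : forall X, hom X (X ⊗ unit_object);
  swap : forall X Y, hom (X ⊗ Y) (Y ⊗ X);
  tensor_id : forall X Y, idm X ⊗ idm Y = idm (X ⊗ Y);
  tensor_comp : forall X X' X'' Y Y' Y''
      (f' : hom X' X'') (f : hom X X') (g' : hom Y' Y'') (g : hom Y Y'),
    (f' ∘ f) ⊗ (g' ∘ g) = (f' ⊗ g') ∘ (f ⊗ g);
  assoc_iso : forall X Y Z,
    mutually_inverse (assoc X Y Z) (assoc_inv X Y Z);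
  left_unitor_iso : forall X,
    mutually_inverse (left_unitor X) (left_unitor_inv X);
  right_unitor_iso : forall X,
    mutually_inverse (right_unitor X) (right_unitor_inv X);
  swap_involutive : forall X Y, swap Y X ∘ swap X Y = idm (X ⊗ Y);
  assoc_natural : forall X X' Y Y' Z Z'
      (f : hom X X') (g : hom Y Y') (h : hom Z Z'),
    assoc X' Y' Z' ∘ ((f ⊗ g) ⊗ h) = (f ⊗ (g ⊗ h)) ∘ assoc X Y Z;
  left_unitor_natural : forall X Y (f : hom X Y),
    left_unitor Y ∘ (idm unit_object ⊗ f) = f ∘ left_unitor X;
  right_unitor_natural : forall X Y (f : hom X Y),
    right_unitor Y ∘ (f ⊗ idm unit_object) = f ∘ right_unitor X;
  swap_natural : forall X X' Y Y' (f : hom X X') (g : hom Y Y'),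
    swap X' Y' ∘ (f ⊗ g) = (g ⊗ f) ∘ swap X Y;
  triangle : forall X Y,
    (idm X ⊗ left_unitor Y) ∘ assoc X unit_object Y = right_unitor X ⊗ idm Y;
  pentagon : forall W X Y Z,
    assoc W X (Y ⊗ Z) ∘ assoc (W ⊗ X) Y Z =
    (idm W ⊗ assoc X Y Z) ∘ (assoc W (X ⊗ Y) Z ∘ (assoc W X Y ⊗ idm Z));
  hexagon : forall X Y Z,
    assoc Y Z X ∘ (swap X (Y ⊗ Z) ∘ assoc X Y Z) =
    (idm Y ⊗ swap X Z) ∘ (assoc Y X Z ∘ (swap X Y ⊗ idm Z))
}.

Arguments unit_object {s}.
Arguments tensor {s} X%_obj Y%_obj.
Arguments tensor_hom {s X X' Y Y'} f%_mor g%_mor.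
Arguments assoc {s} X%_obj Y%_obj Z%_obj.
Arguments assoc_inv {s} X%_obj Y%_obj Z%_obj.
Arguments left_unitor {s} X%_obj.
Arguments left_unitor_inv {s} X%_obj.
Arguments right_unitor {s} X%_obj.
Arguments right_unitor_inv {s} X%_obj.
Arguments swap {s} X%_obj Y%_obj.

Notation "X ⊗ Y" := (tensor X Y) : object_scope.
Notation "f ⊗ g" := (tensor_hom f g) : morphism_scope.

Definition swap_middle (C : symmetric_monoidal_category) (A B X Y : C) :
    hom ((A ⊗ B) ⊗ (X ⊗ Y)) ((A ⊗ X) ⊗ (B ⊗ Y)) :=
  assoc_inv A X (B ⊗ Y) ∘
  ((idm A ⊗ assoc X B Y) ∘
  ((idm A ⊗ (swap B X ⊗ idm Y)) ∘
  ((idm A ⊗ assoc_inv B X Y) ∘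
   assoc A B (X ⊗ Y)))).

Arguments swap_middle {C} A%_obj B%_obj X%_obj Y%_obj.

Record markov_category := MarkovCategory {
  markov_smc :> symmetric_monoidal_category;
  copy : forall X : markov_smc, hom X (X ⊗ X);
  del : forall X : markov_smc, hom X unit_object;
  copy_coassoc : forall X,
    assoc X X X ∘ ((copy X ⊗ idm X) ∘ copy X) = (idm X ⊗ copy X) ∘ copy X;
  copy_counitl : forall X,
    left_unitor X ∘ ((del X ⊗ idm X) ∘ copy X) = idm X;
  copy_counitr : forall X,
    right_unitor X ∘ ((idm X ⊗ del X) ∘ copy X) = idm X;
  copy_cocomm : forall X, swap X X ∘ copy X = copy X;
  del_tensor : forall X Y,
    del (X ⊗ Y) = left_unitor unit_object ∘ (del X ⊗ del Y);
  copy_tensor : forall X Y,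
    copy (X ⊗ Y) = swap_middle X X Y Y ∘ (copy X ⊗ copy Y);
  del_natural : forall X Y (f : hom X Y), del Y ∘ f = del X
}.

Arguments copy {m} X%_obj.
Arguments del {m} X%_obj.

Section MarkovNotions.

Variable C : markov_category.

Definition deterministic (X Y : C) (f : hom X Y) : Prop :=
  copy Y ∘ f = (f ⊗ f) ∘ copy X.

Definition as_eq (T X Y : C) (p : hom T X) (f g : hom X Y) : Prop :=
  (idm X ⊗ f) ∘ copy X ∘ p = (idm X ⊗ g) ∘ copy X ∘ p.

Definition as_deterministic (T X Y : C) (p : hom T X) (f : hom X Y) : Prop :=
  as_eq p (copy Y ∘ f) ((f ⊗ f) ∘ copy X).

Definition strictly_positive : Prop :=
  forall (T X Y Z : C) (p : hom T X) (f : hom X Y) (g : hom Y Z),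
    as_deterministic p (g ∘ f) ->
    as_eq p ((g ⊗ idm Y) ∘ copy Y ∘ f) (((g ∘ f) ⊗ f) ∘ copy X).

Definition sufficient (T X V : C) (p : hom T X) (s : hom X V) : Prop :=
  exists a : hom V X,
    (s ⊗ idm X) ∘ copy X ∘ p = (idm V ⊗ a) ∘ copy V ∘ s ∘ p.

End MarkovNotions.

Arguments strictly_positive C : clear implicits.

(* Main.v *)
(** If [s] is sufficient, discarding [V] in the sufficiency equation gives
    [a ∘ s ∘ p = p], while applying [s] to its [X] output and using that [s] is
    deterministic gives the almost sure equality. For the converse,
    [s ∘ a] is almost surely the identity, hence almost surely deterministic, so
    strict positivity gives
    [(s ⊗ id) ∘ copy ∘ a = ((s ∘ a) ⊗ a) ∘ copy = (id ⊗ a) ∘ copy] almost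
    surely with respect to [s ∘ p]; composing with [s ∘ p] and using
    [a ∘ s ∘ p = p] yields sufficiency. *)
Require Import Defs.

Section AlmostSureEquality.

Set Implicit Arguments.
Unset Strict Implicit.

Variable C : markov_category.

Lemma tensor_comp_idr (X X' Y Y' Y'' : C)
    (f : hom X X') (g' : hom Y' Y'') (g : hom Y Y') :
  f ⊗ (g' ∘ g) = (idm X' ⊗ g') ∘ (f ⊗ g).
Proof. now rewrite <- tensor_comp, comp_idl. Qed.

(** By [del_natural] the leg [f] collapses to [del X], which counitality then cancels against the
    copy. *)
Lemma copy_marginalr (W X Y Z : C) (q : hom W X) (f : hom X Y) (g : hom X Z) :
  left_unitor Z ∘ ((del Y ⊗ idm Z) ∘ ((f ⊗ g) ∘ copy X ∘ q)) = g ∘ q.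
Proof.
  rewrite !comp_assoc; f_equal; rewrite <- !comp_assoc.
  rewrite (comp_assoc (del Y ⊗ idm Z)), <- tensor_comp, del_natural, comp_idl.
  assert (E : del X ⊗ g = (idm unit_object ⊗ g) ∘ (del X ⊗ idm X))
    by now rewrite <- tensor_comp, comp_idl, comp_idr.
  rewrite E, <- comp_assoc, comp_assoc, left_unitor_natural, <- comp_assoc.
  now rewrite copy_counitl, comp_idr.
Qed.

Lemma copy_swap (X Y Z : C) (f : hom X Y) (g : hom X Z) :
  swap Y Z ∘ ((f ⊗ g) ∘ copy X) = (g ⊗ f) ∘ copy X.
Proof.
  now rewrite comp_assoc, swap_natural, <- comp_assoc, copy_cocomm.
Qed.

Lemma as_eq_comp (T X Y Z : C) (q : hom T X) (f g : hom X Y) (h : hom Y Z) :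
  as_eq q f g -> as_eq q (h ∘ f) (h ∘ g).
Proof.
  unfold as_eq; intros H.
  rewrite !tensor_comp_idr, <- !comp_assoc.
  rewrite <- !comp_assoc in H.
  now rewrite H.
Qed.

Lemma as_eq_marginal (T X Y : C) (q : hom T X) (f g : hom X Y) :
  as_eq q f g -> f ∘ q = g ∘ q.
Proof.
  unfold as_eq; intros H.
  now rewrite <- (copy_marginalr q (idm X) f), H, copy_marginalr.
Qed.

(** By coassociativity, the joint of [X] with the pair is obtained from the joint of [X] with [u] by
    a map independent of [u]: copy [X] once more and apply [k]. *)
Lemma as_eq_pairr (T X Y Z : C) (q : hom T X) (k : hom X Z) (f g : hom X Y) :
  as_eq q f g -> as_eq q ((k ⊗ f) ∘ copy X) ((k ⊗ g) ∘ copy X).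
Proof.
  unfold as_eq; intros H.
  assert (E : forall u : hom X Y,
    (idm X ⊗ ((k ⊗ u) ∘ copy X)) ∘ copy X ∘ q =
    assoc X Z Y ∘ ((((idm X ⊗ k) ∘ copy X) ⊗ idm Y) ∘
      ((idm X ⊗ u) ∘ copy X ∘ q))).
  { intros u.
    rewrite tensor_comp_idr, <- (comp_assoc (idm X ⊗ (k ⊗ u))), <- copy_coassoc.
    rewrite (comp_assoc (idm X ⊗ (k ⊗ u))), <- assoc_natural, <- !comp_assoc.
    f_equal.
    rewrite !comp_assoc, <- !tensor_comp.
    now rewrite !comp_idl, !comp_idr. }
  now rewrite !E, H.
Qed.

(** Cocommutativity reduces this to the other leg, up to postcomposition with [swap]. *)
Lemma as_eq_pairl (T X Y Z : C) (q : hom T X) (f g : hom X Y) (k : hom X Z) :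
  as_eq q f g -> as_eq q ((f ⊗ k) ∘ copy X) ((g ⊗ k) ∘ copy X).
Proof.
  intros H.
  rewrite <- (copy_swap k f), <- (copy_swap k g).
  now apply as_eq_comp, as_eq_pairr.
Qed.

Lemma as_eq_trans (T X Y : C) (q : hom T X) (f g h : hom X Y) :
  as_eq q f g -> as_eq q g h -> as_eq q f h.
Proof. unfold as_eq; congruence. Qed.

Lemma as_eq_sym (T X Y : C) (q : hom T X) (f g : hom X Y) :
  as_eq q f g -> as_eq q g f.
Proof. unfold as_eq; congruence. Qed.

(** The identity is deterministic, and the two legs of [f ⊗ f] can be replaced by it one at a
    time. *)
Lemma as_deterministic_id (T X : C) (q : hom T X) (f : hom X X) :
  as_eq q f (idm X) -> as_deterministic q f.
Proof.
  intros H; unfold as_deterministic.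
  apply (as_eq_trans (g := (idm X ⊗ idm X) ∘ copy X)).
  - apply (as_eq_comp (copy X)) in H.
    now rewrite comp_idr in H; rewrite tensor_id, comp_idl.
  - apply as_eq_sym, (as_eq_trans (g := (f ⊗ idm X) ∘ copy X)).
    + now apply as_eq_pairr.
    + now apply as_eq_pairl.
Qed.

End AlmostSureEquality.

Theorem theorem14p5 (C : markov_category) (hC : strictly_positive C)
    (T X V : C) (p : hom T X) (s : hom X V) (hs : deterministic s) :
  sufficient p s <->
  exists a : hom V X, a ∘ s ∘ p = p /\ as_eq (s ∘ p) (s ∘ a) (idm V).
Proof.
  split; intros [a Ha]; exists a.
  - split.
    + rewrite <- comp_assoc, <- (copy_marginalr (s ∘ p) (idm V) a).
      rewrite (comp_assoc _ s), <- Ha, copy_marginalr.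
      apply comp_idl.
    + unfold as_eq.
      rewrite tensor_id, comp_idl, tensor_comp_idr, <- !comp_assoc.
      rewrite <- !comp_assoc in Ha.
      rewrite <- Ha, !comp_assoc, <- tensor_comp, comp_idl, comp_idr.
      now rewrite <- hs.
  - destruct Ha as [Hp Hs].
    (* The inferred composite is [a] followed by [s], taken over the model [s ∘ p]. *)
    pose proof (hC _ _ _ _ _ _ _ (as_deterministic_id Hs)) as H.
    apply (fun H => as_eq_trans H (as_eq_pairl a Hs)) in H.
    apply as_eq_marginal in H.
    rewrite <- !comp_assoc in *.
    now rewrite Hp in H.
Qed.
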